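(* Let $R$ be a finite commutative ring, and let $n_2(R)$ be the number of ideals of $R$ of index two (such ideals are prime and maximal). Then $D(R) \le D(U(R)) + n_2(R)$.
   Context: Rings are commutative and unital. For a commutative semigroup $S$ with identity, written multiplicatively, a finite sequence $A$ of elements of $S$ has product $\pi(A)$, the empty sequence having product $1$. The sequence $A$ is reducible if there is a proper subsequence $A' \subsetneq A$ (possibly empty) with $\pi(A') = \pi(A)$; otherwise it is irreducible. The Davenport constant $D(S)$ is the minimum positive integer $k$ such that every sequence of $k$ elements of $S$ is reducible (with $D(S)=\infty$ if no such $k$ exists). For a ring $R$, $D(R)$ denotes $D$ of the semigroup of all elements of $R$ under multiplication, and $U(R)$ is the group of units of $R$. *)

(* Defs.v *)
From HB Require Import structures.
From mathcomp Require Import all_boot all_fingroup all_algebra.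

Set Implicit Arguments.
Unset Strict Implicit.
Unset Printing Implicit Defensive.

Import GRing.Theory.

(* A finite commutative monoid is a finType with a Monoid.com_law, so that    *)
(* the multiplication of a ring qualifies without any repackaging.            *)
Section Davenport.
Variables (S : finType) (e : S) (op : Monoid.com_law e).

(* A subsequence is the set of positions it retains; it is proper when some   *)
(* position is dropped, even if the dropped value also occurs elsewhere.      *)
Definition reducible (k : nat) (A : k.-tuple S) : bool :=
  [exists I : {set 'I_k}, (I \proper [set: 'I_k]) &&
    (\big[op/e]_(i in I) tnth A i == \big[op/e]_(i < k) tnth A i)].

(* Two of the #|S|.+1 initial products coincide: drop what lies between.      *)
Lemma reducible_card (A : #|S|.-tuple S) : reducible A.
Proof.
pose f (i : 'I_#|S|.+1) := \big[op/e]_(l < #|S| | l < i) tnth A l.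
have [i [j [ltij eqf]]] : exists i j : 'I_#|S|.+1, i < j /\ f i = f j.
  have /injectivePn[i [j neij eqf]] : ~~ injectiveb f.
    apply/negP=> /injectiveP/leq_card; by rewrite card_ord ltnn.
  case: (ltngtP i j) => [lt|lt|eqij]; first by exists i, j.
    by exists j, i.
  by rewrite (val_inj eqij) eqxx in neij.
have ltik : i < #|S| by rewrite (leq_trans ltij) // -ltnS.
apply/existsP; exists [set l : 'I_#|S| | ~~ (i <= l < j)].
apply/andP; split.
  rewrite properT; apply/eqP=> /setP/(_ (Ordinal ltik)).
  by rewrite !inE /= leqnn ltij.
apply/eqP; rewrite [RHS](bigID (fun l : 'I_#|S| => l < j)) /=.
rewrite [LHS](bigID (fun l : 'I_#|S| => l < j)) /=; congr (op _ _); last first.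
  by apply: eq_bigl => l; rewrite !inE; case: (l < j); rewrite ?andbF.
rewrite -[RHS]eqf; apply: eq_bigl => l; rewrite !inE negb_and -ltnNge.
case: (ltnP l i) => [lti|_] /=; first by rewrite (ltn_trans lti).
by rewrite andNb.
Qed.

Lemma davenport_subproof :
  exists k, (0 < k) && [forall A : k.-tuple S, reducible A].
Proof.
exists #|S|; apply/andP; split; first by apply/card_gt0P; exists e.
by apply/forallP=> A; apply: reducible_card.
Qed.

(* The minimum is attained because S is finite, so the value is a nat.        *)
Definition davenport : nat := ex_minn davenport_subproof.

End Davenport.

Local Open Scope ring_scope.

(* {unit R} would exclude the zero ring, hence this version of U(R).          *)
Section Units.
Variable R : finComPzRingType.

Definition units : finType := {x : R | [exists y : R, x * y == 1]}.

Lemma units1_subproof : [exists y : R, 1 * y == 1].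
Proof. by apply/existsP; exists 1; rewrite mulr1. Qed.

Definition units1 : units := exist _ 1 units1_subproof.

Lemma unitsM_subproof (u v : units) : [exists y : R, val u * val v * y == 1].
Proof.
case: u v => [u /existsP[u' /eqP uK]] [v /existsP[v' /eqP vK]] /=.
by apply/existsP; exists (u' * v'); rewrite mulrACA uK vK mulr1.
Qed.

Definition unitsM (u v : units) : units :=
  exist _ (val u * val v) (unitsM_subproof u v).

Lemma unitsMA : associative unitsM.
Proof. by move=> u v w; apply: val_inj; rewrite /= mulrA. Qed.

Lemma unitsMC : commutative unitsM.
Proof. by move=> u v; apply: val_inj; rewrite /= mulrC. Qed.

Lemma units1M : left_id units1 unitsM.
Proof. by move=> u; apply: val_inj; rewrite /= mul1r. Qed.

HB.instance Definition _ :=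
  Monoid.isComLaw.Build units units1 unitsM unitsMA unitsMC units1M.

End Units.

(* The additive group structure that finalg declares for finZmodType and      *)
(* finNzRingType, but not for finComPzRingType.                               *)
#[non_forgetful_inheritance]
HB.instance Definition _ (R : finComPzRingType) := [finGroupMixin of R for +%R].

Section IndexTwo.
Variable R : finComPzRingType.

(* ring_quotient.idealr_closed only describes proper ideals of nonzero rings. *)
Definition is_ideal (I : {set R}) : bool :=
  [&& 0 \in I, [forall x in I, forall y in I, x + y \in I]
    & [forall a : R, forall x in I, a * x \in I]].

Definition n2 : nat :=
  #|[set I : {set R} | is_ideal I && (#|[set: R] : I|%g == 2%N)]|.

End IndexTwo.

Definition davenport_ring (R : finComPzRingType) : nat :=
  davenport (@GRing.mul R : Monoid.com_law (1 : R)).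

Definition davenport_units (R : finComPzRingType) : nat :=
  davenport (@unitsM R : Monoid.com_law (units1 R)).

(* Main.v *)
Require Import Defs.
From HB Require Import structures.
From mathcomp Require Import all_boot all_fingroup all_algebra.
From mathcomp Require Import ring.

(** Let [a] be a sequence of length at least D(U(R)) + n_2(R). The aim is a
    nonempty set of positions that can be dropped without changing the product.

    Take a minimal set B of positions whose product b generates the same ideal
    as the product of all of [a]. An entry outside of B multiplies b to another
    generator of bR, so on b it acts as some unit of R. For a position j in B,
    let p be the product of the entries of B before j. By minimality of B the
    annihilator of p is strictly smaller than that of [p * a j]. Hence
    ([unit_or_index2]) one of two things happens: either some unit fixes
    [p * a j] but not p, or some ideal of index two contains Ann(p) and not
    Ann(p * a j). The ideals obtained in the second case are distinct, because
    the annihilators increase along B; so it happens at most n_2(R) times, and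
    at least D(U(R)) positions carry a unit.

    Some nonempty subfamily of these units has product 1. If it came from
    positions of B only, then its last unit would fix the prefix product before
    its position, as all the other units of the subfamily do: a contradiction.
    So it uses a nonempty set C of positions outside of B. The units of B fix
    b, so the entries in C together fix b, and they can be dropped.

    The dichotomy [unit_or_index2] for ideals I and J, J not inside I, rests on
    the fact that every element of a finite ring has an idempotent power: an
    element of J that is nilpotent modulo I yields a unit 1 + y with y in J but
    not in I, and otherwise J contains an idempotent e not in I. If all units in
    1 + J lie in 1 + I, an ideal M above I that is maximal without e is prime,
    and every element of R is 0 or 1 modulo M. *)

Set Implicit Arguments.
Unset Strict Implicit.
Unset Printing Implicit Defensive.

Import GRing.Theory.
Local Open Scope ring_scope.

(** * The Davenport constant as a bound *)

Lemma davenport_le (S : finType) (e : S) (op : Monoid.com_law e) (k : nat) :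
  (0 < k)%N -> (forall A : k.-tuple S, reducible op A) ->
  (davenport op <= k)%N.
Proof.
move=> k_gt0 redA; rewrite /davenport; case: ex_minnP => d _; apply.
by rewrite k_gt0; apply/forallP.
Qed.

Lemma davenportP (S : finType) (e : S) (op : Monoid.com_law e) :
  (0 < davenport op)%N /\ forall A : (davenport op).-tuple S, reducible op A.
Proof. by rewrite /davenport; case: ex_minnP => d /andP[? /forallP]. Qed.

(** * Units and ideals of a finite commutative ring *)

Section Ring.
Variable R : finComPzRingType.
Implicit Types (x y a e p : R) (u : units R) (I J M : {set R}).

Lemma unit_cancel u x y : x * val u = y * val u -> x = y.
Proof.
case: u => v /= /existsP[w /eqP vw1] eq_xy.
by rewrite -[x]mulr1 -[y]mulr1 -vw1 !mulrA eq_xy.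
Qed.

Lemma val_unitsM (K : finType) (P : pred K) (h : K -> units R) :
  val (\big[@unitsM R/units1 R]_(i | P i) h i) = \prod_(i | P i) val (h i).
Proof. exact: (big_morph val (fun _ _ => erefl) erefl). Qed.

(** In a group the product of the retained terms of a reducible sequence can be
    cancelled, and that of the dropped terms remains. *)
Lemma unit_subproduct_eq1 (K : finType) (h : K -> units R) (P : {set K}) :
  (davenport_units R <= #|P|)%N ->
  exists T : {set K},
    [/\ T \subset P, T != set0 & \prod_(i in T) val (h i) = 1].
Proof.
move=> leDP.
have [_ red] := davenportP (@unitsM R : Monoid.com_law (units1 R)).
pose f (i : 'I_(davenport_units R)) : K := enum_val (widen_ord leDP i).
have f_inj : injective f.
  by move=> i j /enum_val_inj/(congr1 val)/= /val_inj.
have /existsP[I /andP[]] := red [tuple h (f i) | i < davenport_units R].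
rewrite properT => I_neqT /eqP/(congr1 val).
rewrite !val_unitsM.
under eq_bigr do rewrite tnth_mktuple.
under [in RHS]eq_bigr do rewrite tnth_mktuple.
move=> eqI; exists (f @: ~: I); split.
- by apply/subsetP=> _ /imsetP[i _ ->]; apply: enum_valP.
- by rewrite imset_eq0 -setCT (inj_eq (@setC_inj _)).
rewrite big_imset => [|i j _ _ /f_inj//].
apply: (@unit_cancel (\big[@unitsM R/units1 R]_(i in I) h (f i))).
rewrite val_unitsM mul1r [RHS]eqI [RHS](bigID (mem I)) /= mulrC.
by congr (_ * _); apply: eq_bigl => i; rewrite inE.
Qed.

(** The powers of x are eventually periodic, of some period d; a positive
    multiple of d beyond the start of the period is an exponent equal to its
    double modulo d. *)
Lemma idempotent_power x : exists n, x ^+ n.+1 * x ^+ n.+1 = x ^+ n.+1.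
Proof.
pose f (i : 'I_#|R|.+1) := x ^+ i.
have /injectivePn[i [j neij eqf]] : ~~ injectiveb f.
  by apply/negP=> /injectiveP/leq_card; rewrite card_ord ltnn.
wlog ltij : i j neij eqf / (i < j)%N => [wl|].
  case: (ltngtP i j) => [lt|lt|eqij]; first exact: (wl i j).
    by apply: (wl j i) => //; rewrite eq_sym.
  by rewrite (val_inj eqij) eqxx in neij.
pose d := (j - i)%N.
have d_gt0 : (0 < d)%N by rewrite subn_gt0.
have per m q : (i <= m)%N -> x ^+ (m + q * d) = x ^+ m.
  move=> leim; elim: q => [|q IHq]; first by rewrite addn0.
  rewrite mulSn addnCA addnA -IHq !exprD; congr (_ * _).
  rewrite -exprD -(subnKC leim) addnA /d subnK ?(ltnW ltij) //.
  by rewrite !exprD; congr (_ * _).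
(* The factor i.+1 makes the exponent at least i, where the period starts. *)
exists (i.+1 * d).-1; rewrite prednK ?muln_gt0 // -exprD per //.
by rewrite (leq_trans (leqnSn i)) // leq_pmulr.
Qed.

Lemma unit_of_inverse x y : x * y = 1 -> exists u, val u = x.
Proof.
move=> xy1; have xP : [exists y, x * y == 1].
  by apply/existsP; exists y; apply/eqP.
by exists (exist _ x xP).
Qed.

(** The idempotent f splits R into f R, in which a is invertible, and
    (1 - f) R; this unit is a on the former and 1 on the latter. *)
Lemma unit_of_power a n : let f := a ^+ n.+1 in f * f = f ->
  exists u, val u = a * f + (1 - f).
Proof.
move=> f ff; apply: (@unit_of_inverse _ (a ^+ n * f + (1 - f))).
have -> : (a * f + (1 - f)) * (a ^+ n * f + (1 - f)) =
    a * a ^+ n * (f * f) + (a + a ^+ n) * (f - f * f) + (1 - f - (f - f * f)).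
  by ring.
by rewrite -exprS -/f !ff subrr mulr0 addr0 subr0 subrKC.
Qed.

Lemma idealP I : reflect
  [/\ 0 \in I, forall x y, x \in I -> y \in I -> x + y \in I
    & forall a x, x \in I -> a * x \in I] (is_ideal I).
Proof.
apply: (iffP and3P) => [[I0 /forall_inP ID /forallP IM]|[I0 ID IM]]; split=> //.
- by move=> x y xI yI; apply: (forall_inP (ID x xI)).
- by move=> a x xI; apply: (forall_inP (IM a)).
- by apply/forall_inP=> x xI; apply/forall_inP=> y yI; apply: ID.
- by apply/forallP=> a; apply/forall_inP=> x; apply: IM.
Qed.

Lemma index2P M : is_ideal M -> 1 \notin M ->
  (forall a, a \in M \/ a - 1 \in M) -> #|[set: R] : M|%g = 2%N.
Proof.
move=> /idealP[M0 MD MM] M1 Mtot.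
have rcE x y : (y \in (M :* x)%g) = (y - x \in M).
  apply/rcosetP/idP => [[z zM ->]|yxM].
    by rewrite -[(z * x)%g]/(z + x) addrK.
  by exists (y - x) => //; rewrite -[((y - x) * x)%g]/((y - x) + x) subrK.
have MN x : x \in M -> - x \in M by rewrite -mulN1r; apply: MM.
have rc_eq x y : x - y \in M -> (M :* x)%g = (M :* y)%g.
  move=> xyM; apply/setP=> z; rewrite !rcE; apply/idP/idP => zM.
    by rewrite -[z](subrK x) -addrA; apply: MD.
  by rewrite -[z](subrK y) -addrA; apply: MD; rewrite // -opprB; apply: MN.
rewrite /indexg.
have -> : rcosets M [set: R] = [set (M :* 0%R)%g; (M :* 1%R)%g].
  apply/setP=> C; rewrite !inE; apply/imsetP/orP => [[x _ ->]|].
    rewrite /= !rcosetE.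
    by case: (Mtot x) => xM; [left|right]; apply/eqP; apply: rc_eq;
      rewrite ?subr0.
  by case=> /eqP->; [exists (0 : R)|exists (1 : R)]; rewrite ?inE /= ?rcosetE.
rewrite cards2; case: eqP => // /setP/(_ 1); rewrite !rcE subrr M0 subr0.
by rewrite (negPf M1).
Qed.

(** An ideal M above I that is maximal among those without e is prime. If a is
    not in M, neither is the idempotent f, a power of [a * e]; the unit that is
    a on f R and 1 on (1 - f) R differs from 1 by [f * (a - 1)], which is in J,
    thus in I and in M. So [a - 1] is in M, which shows that R / M has two
    elements. *)
Lemma index2_of_idempotent I J e :
  is_ideal I -> is_ideal J -> e * e = e -> e \in J -> e \notin I ->
  (forall u, val u - 1 \in J -> val u - 1 \in I) ->
  exists M, [/\ is_ideal M, #|[set: R] : M|%g = 2%N, I \subset M & e \notin M].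
Proof.
move=> Iid /idealP[_ _ JM] ee eJ eI unitJI.
have [M /maxsetP[/and3P[Mid sIM eM] maxM] _] :
    {M | maxset (fun M => [&& is_ideal M, I \subset M & e \notin M]) M
       & I \subset M}.
  by apply: maxset_exists; rewrite Iid subxx.
exists M; split=> //; have /idealP[M0 MD MM] := Mid.
(* By maximality, e lies in the ideal generated by M and any a outside of M.  *)
have e_mod a : a \notin M -> exists r, e - r * a \in M.
  move=> aM; apply/existsP; apply: contraT => /existsPn no_r.
  case/negP: aM; pose N := [set x | [exists r, x - r * a \in M]].
  have sMN : M \subset N.
    apply/subsetP=> x xM; rewrite inE; apply/existsP; exists 0.
    by rewrite mul0r subr0.
  suff <- : N = M by rewrite inE; apply/existsP; exists 1; rewrite mul1r subrr.
  apply: maxM => //; apply/and3P; split; last by rewrite inE; apply/existsPn.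
    apply/idealP; split.
    - by apply: (subsetP sMN).
    - move=> x y; rewrite !inE => /existsP[r rM] /existsP[s sM].
      by apply/existsP; exists (r + s); rewrite mulrDl opprD addrACA; apply: MD.
    - move=> c x; rewrite !inE => /existsP[r rM].
      by apply/existsP; exists (c * r); rewrite -mulrA -mulrBr; apply: MM.
  exact: subset_trans sMN.
apply: index2P => //.
  by apply: contra eM => M1; rewrite -[e]mulr1; apply: MM.
have prime x y : x * y \in M -> x \in M \/ y \in M.
  move=> xyM; have [|xM] := boolP (x \in M); [by left | right].
  apply: contraT => yM; case/negP: eM.
  have [r rM] := e_mod _ xM; have [s sM] := e_mod _ yM.
  have -> : e = e * (e - r * x) + r * x * (e - s * y) + r * s * (x * y).
    by rewrite -[LHS]ee; ring.
  by apply: (MD _ _ (MD _ _ _ _)); apply: MM.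
move=> a; have [n ff] := idempotent_power (a * e).
set f := (a * e) ^+ n.+1 in ff.
have [u uE] := unit_of_power ff.
have fE : f = (a * e) ^+ n * a * e by rewrite /f exprSr mulrA.
have ef : e * f = f by rewrite fE mulrCA ee.
have u1E : val u - 1 = f * (a - 1) by rewrite uE -/f -[a * e * f]mulrA ef; ring.
have : f * (a - 1) \in M.
  rewrite -u1E; apply: (subsetP sIM); apply: unitJI.
  by rewrite u1E fE mulrAC; apply: JM.
case/prime => [|aM]; [|by right].
rewrite /f; elim: (n) => [|m IHm].
  by case/prime => [aM|eM']; [left | rewrite eM' in eM].
by rewrite exprS => /prime[/prime[aM|eM']|/IHm//]; [left | rewrite eM' in eM].
Qed.

(** Either J contains an idempotent outside of I, to which
    [index2_of_idempotent] applies, or it contains a nilpotent element y outside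
    of I, and 1 + y is a unit. *)
Lemma unit_or_index2 I J : is_ideal I -> is_ideal J -> ~~ (J \subset I) ->
  (exists u, val u - 1 \in J /\ val u - 1 \notin I) \/
  (exists M, [/\ is_ideal M, #|[set: R] : M|%g = 2%N, I \subset M
    & ~~ (J \subset M)]).
Proof.
move=> Iid Jid /subsetPn[x xJ xI].
have [/existsP[u /andP[]]|/existsPn no_unit] :=
    boolP [exists u : units R, (val u - 1 \in J) && (val u - 1 \notin I)].
  by left; exists u.
right; have unitJI u : val u - 1 \in J -> val u - 1 \in I.
  by move=> uJ; have:= no_unit u; rewrite uJ negbK.
have [/idealP[_ ID IM] /idealP[_ _ JM]] := (Iid, Jid).
have [n ee] := idempotent_power x; set e := x ^+ n.+1 in ee.
have eJ : e \in J by rewrite /e exprSr; apply: JM.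
have [eI|eI] := boolP (e \in I); last first.
  have [M [Mid M2 sIM eM]] := index2_of_idempotent Iid Jid ee eJ eI unitJI.
  by exists M; split=> //; apply/subsetPn; exists e.
(* Here e is in I, so that y is congruent to x modulo I; moreover y is        *)
(* nilpotent, whereas x only is so modulo I.                                  *)
case/negP: xI; set y := (1 - e) * x.
have y0 : (- y) ^+ n.+1 = 0.
  rewrite exprNn exprMn -/e [(1 - e) ^+ _]exprSr -!mulrA mulrBl ee mul1r.
  by rewrite subrr !mulr0.
have [u uE] : exists u, val u = 1 + y.
  apply: (@unit_of_inverse _ (\sum_(i < n.+1) (- y) ^+ i)).
  have := subrX1 (- y) n.+1; rewrite y0 => /(congr1 -%R).
  by rewrite -mulNr !opprB subr0 opprK => <-.
have -> : x = (val u - 1) + x * e by rewrite uE /y; ring.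
apply: ID; last exact: IM.
by apply: unitJI; rewrite uE addrC addKr; apply: JM.
Qed.

Definition ann p : {set R} := [set x | x * p == 0].

Lemma ann_ideal p : is_ideal (ann p).
Proof.
apply/idealP; split=> [|x y|a x]; rewrite !inE ?mul0r // => /eqP xp0.
  by move=> /eqP yp0; rewrite mulrDl xp0 yp0 addr0.
by rewrite -mulrA xp0 mulr0.
Qed.

Lemma annB1 p x : (x - 1 \in ann p) = (x * p == p).
Proof. by rewrite inE mulrBl mul1r subr_eq0. Qed.

(** Multiplication by a is injective on pR, hence surjective since pR is finite.
    The proof produces the preimage of p: if e is an idempotent power of a, then
    (1 - e) p is killed by a power of a, so it is 0. *)
Lemma ann_stable p a : ann (p * a) \subset ann p -> exists r, p = p * a * r.
Proof.
move=> sub_ann; have [n aa] := idempotent_power a.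
exists (a ^+ n); rewrite -mulrA -exprS; set e := a ^+ n.+1 in aa *.
have ann_pow k x : x * p * a ^+ k = 0 -> x * p = 0.
  elim: k x => [|k IHk] x; first by rewrite mulr1.
  move=> xp0; have xap0 : x * a * p = 0 by apply: IHk; rewrite -xp0 exprS; ring.
  have /(subsetP sub_ann) : x \in ann (p * a).
    by rewrite inE [p * a]mulrC mulrA xap0.
  by rewrite inE => /eqP.
apply/eqP; rewrite -subr_eq0; apply/eqP.
have -> : p - p * e = (1 - e) * p by ring.
by apply: (ann_pow n.+1); rewrite -/e mulrAC mulrBl mul1r aa subrr mul0r.
Qed.

(** Since a is invertible on pR, so are its powers; one of them is idempotent,
    which is then the identity on pR, and the unit of [unit_of_power] acts on
    pR as a does. *)
Lemma unit_of_associate p a r : p = p * a * r -> exists u, val u * p = a * p.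
Proof.
move=> pE; have [n ee] := idempotent_power a.
have [u uE] := unit_of_power ee; exists u; rewrite uE.
set e := a ^+ n.+1 in ee *.
have pX k : p = p * a ^+ k * r ^+ k.
  elim: k => [|k IHk]; first by rewrite !mulr1.
  by rewrite {1}pE {1}IHk !exprS; ring.
have ep : e * p = p.
  transitivity (p * (e * e) * r ^+ n.+1); last by rewrite ee -pX.
  by rewrite {1}(pX n.+1) -/e; ring.
by rewrite mulrDl mulrBl mul1r -mulrA ep subrr addr0.
Qed.

End Ring.

(** * Dropping positions from a long sequence *)

Section Sequence.
Variables (R : finComPzRingType) (k : nat) (a : 'I_k -> R).
Implicit Types (S T B : {set 'I_k}) (M : {set R}).

Definition subprod S := \prod_(i in S) a i.
Definition below B (j : 'I_k) := [set i in B | (i < j)%N].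
Definition upto B (j : 'I_k) := [set i in B | (i <= j)%N].

Lemma subprodS S T : S \subset T -> subprod T = subprod S * subprod (T :\: S).
Proof. by move=> sST; rewrite /subprod (big_setID S) /= (setIidPr sST). Qed.

Lemma subprod_fixS S T x :
  S \subset T -> x * subprod S = subprod S -> x * subprod T = subprod T.
Proof. by move=> sST xS; rewrite (subprodS sST) mulrA xS. Qed.

Lemma upto_sub B j : upto B j \subset B.
Proof. by apply/subsetP=> i; rewrite inE => /andP[]. Qed.

Lemma upto_sub_below B (i j : 'I_k) :
  (i < j)%N -> upto B i \subset below B j.
Proof.
move=> ltij; apply/subsetP=> l; rewrite !inE => /andP[-> leli].
exact: leq_ltn_trans ltij.
Qed.

Lemma below_sub_rem B j : below B j \subset B :\ j.
Proof.
apply/subsetP=> i; rewrite !inE => /andP[-> ltij]; rewrite andbT.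
by apply: contraTneq ltij => ->; rewrite ltnn.
Qed.

Lemma rem_below B j : (B :\ j) :\: below B j = B :\: upto B j.
Proof.
apply/setP=> i; rewrite !inE; case: (i \in B); rewrite ?andbF //= !andbT.
by rewrite -leqNgt -ltnNge ltn_neqAle eq_sym andbC.
Qed.

Lemma subprod_upto B j :
  j \in B -> subprod (below B j) * a j = subprod (upto B j).
Proof.
move=> jB; rewrite mulrC [RHS](bigD1 j) ?inE ?jB ?leqnn //=; congr (_ * _).
apply: eq_bigl => i; rewrite !inE -andbA ltn_neqAle.
by rewrite [(i != j :> nat) && _]andbC.
Qed.

(** The product of B divides that of the whole sequence in any case, so these
    conditions say that B is minimal among the sets of positions whose product
    generates the same ideal as that of the whole sequence. *)
Definition minimal_associate B :=
  (exists r, subprod B = subprod setT * r) /\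
  (forall i r, i \in B -> subprod (B :\ i) <> subprod B * r).

Lemma minimal_associate_ex : exists B, minimal_associate B.
Proof.
have [B /minsetP[/existsP[r /eqP Br] minB] _] :
    {B | minset (fun B => [exists r, subprod B == subprod setT * r]) B
       & B \subset setT}.
  by apply: minset_exists; apply/existsP; exists 1; rewrite mulr1.
exists B; split; first by exists r.
move=> i s iB Bi; have: B :\ i = B.
  apply: minB; last exact: subsetDl.
  by apply/existsP; exists (r * s); rewrite Bi Br mulrA.
by move/setP/(_ i); rewrite !inE eqxx iB.
Qed.

Definition separates B j M :=
  [&& is_ideal M, #|[set: R] : M|%g == 2%N,
      ann (subprod (below B j)) \subset M
    & ~~ (ann (subprod (below B j) * a j) \subset M)].

Definition separated B := [set j in B | [exists M, separates B j M]].

(** Distinct positions need distinct ideals: along B the annihilators of the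
    prefix products increase, so an ideal that fails to contain one of them
    cannot contain a later one. *)
Lemma card_separated_le B : (#|separated B| <= n2 R)%N.
Proof.
have /fin_all_exists[m mP] (j : 'I_k) :
    exists M, j \in separated B -> separates B j M.
  have [|_] := boolP (j \in separated B); last by exists set0.
  by rewrite inE => /andP[_ /existsP[M ?]]; exists M.
rewrite -(@card_in_imset _ _ m).
  apply/subset_leq_card/subsetP=> _ /imsetP[j /mP/and4P[? ? _ _] ->].
  by rewrite inE; apply/andP.
have m_neq i j : i \in separated B -> j \in separated B -> (i < j)%N ->
    m i <> m j.
  move=> iZ jZ ltij eq_m.
  have /and4P[_ _ _ /negP[]] := mP i iZ; have /and4P[_ _ + _] := mP j jZ.
  rewrite eq_m; apply: subset_trans; apply/subsetP=> x.
  have iB : i \in B by move: iZ; rewrite inE => /andP[].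
  rewrite subprod_upto // !inE => /eqP x0.
  by rewrite (subprodS (upto_sub_below B ltij)) mulrA x0 mul0r.
move=> i j iZ jZ eq_m; case: (ltngtP i j) => [lt|lt|/val_inj//].
  by case: (m_neq i j).
by case: (m_neq j i).
Qed.

(** The two cases serve different purposes: outside of B the unit imitates the
    entry at j, while inside B it witnesses that the annihilator of the prefix
    product grows at j, much as in a strictly increasing chain of subgroups. *)
Definition represents B j (u : units R) :=
  if j \in B then
    val u * subprod (upto B j) = subprod (upto B j)
    /\ val u * subprod (below B j) <> subprod (below B j)
  else val u * subprod B = a j * subprod B.

Lemma represents_ex B j :
  minimal_associate B -> j \notin separated B -> exists u, represents B j u.
Proof.
move=> [[r Br] minB]; rewrite /represents; have [jB jZ|jB _] := boolP (j \in B).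
  have nsub : ~~ (ann (subprod (below B j) * a j)
                    \subset ann (subprod (below B j))).
    apply/negP=> /ann_stable[s sP]; case: (minB j s) => //.
    rewrite (subprodS (below_sub_rem B j)) sP subprod_upto // mulrAC.
    by rewrite rem_below -(subprodS (upto_sub B j)).
  have [] := unit_or_index2 (ann_ideal _) (ann_ideal _) nsub.
    move=> [u]; rewrite !annB1 subprod_upto // => -[/eqP ? /eqP ?].
    by exists u.
  move=> [M [? /eqP ? ? ?]]; case/negP: jZ; rewrite inE jB.
  by apply/existsP; exists M; apply/and4P.
(* The product of B is a multiple of that of the whole sequence, hence of its *)
(* own product with the entry at j.                                           *)
apply: (@unit_of_associate _ _ _ (subprod (~: B :\ j) * r)).
rewrite {1}Br (subprodS (subsetT B)) setTD.
by rewrite [subprod (~: B)](@big_setD1 _ _ _ _ j) ?inE //= !mulrA.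
Qed.

Lemma prod_act S (g h : 'I_k -> R) p :
  (forall i, i \in S -> g i * p = h i * p) ->
  \prod_(i in S) g i * p = \prod_(i in S) h i * p.
Proof.
move=> gh; elim/big_rec2: _ => // i x y iS eq_xy.
by rewrite -!mulrA eq_xy mulrCA gh // mulrCA.
Qed.

(** A relation among the units that represent the entries cannot involve
    positions of B only: its last factor would fix the prefix product before
    it, because the earlier factors do. So it involves positions outside of B,
    whose entries have a product that fixes the product of B. *)
Lemma dropped_subproduct : (davenport_units R + n2 R <= k)%N ->
  exists T, T != set0 /\ subprod (~: T) = subprod setT.
Proof.
move=> le_k; have [B minB] := minimal_associate_ex.
have act_ex (j : 'I_k) :
    exists u, j \in ~: separated B -> represents B j u.
  rewrite inE; have [_|jZ] := boolP (j \in separated B).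
    by exists (units1 R).
  by have [u] := represents_ex minB jZ; exists u.
have {act_ex}[u uP] := fin_all_exists act_ex.
have leP : (davenport_units R <= #|~: separated B|)%N.
  rewrite -(leq_add2r (n2 R)) (leq_trans le_k) // -[k in (k <= _)%N]card_ord.
  by rewrite -(cardsC (separated B)) addnC leq_add2l card_separated_le.
have [T [sTZ T0 T1]] := unit_subproduct_eq1 u leP.
have {sTZ}uT j : j \in T -> represents B j (u j).
  by move=> /(subsetP sTZ); apply: uP.
exists (T :\: B); split.
  rewrite setD_eq0; apply/negP=> sTB.
  have [j jT maxj] : exists2 j, j \in T & forall i, i \in T -> (i <= j)%N.
    have [j0 j0T] := set0Pn _ T0.
    case: (arg_maxnP (fun i : 'I_k => i : nat) j0T) => j jT maxj.
    by exists j.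
  have := uT j jT; rewrite /represents (subsetP sTB) // => -[_]; apply.
  transitivity (\prod_(i in T) val (u i) * subprod (below B j)).
    rewrite (big_setD1 j jT) /= -mulrA; congr (_ * _).
    rewrite (@prod_act _ _ (fun=> 1)) ?big1 ?mul1r // => i.
    rewrite !inE => /andP[neij iT].
    have := uT i iT; rewrite /represents (subsetP sTB) // => -[fix_i _].
    apply: subprod_fixS fix_i; apply: upto_sub_below.
    by rewrite ltn_neqAle neij maxj.
  by rewrite T1 mul1r.
have TB : subprod (T :\: B) * subprod B = subprod B.
  transitivity (\prod_(i in T) val (u i) * subprod B); last first.
    by rewrite T1 mul1r.
  symmetry.
  rewrite (@prod_act _ _ (fun i => if i \in B then 1 else a i)) => [|i iT].
    rewrite (big_setID B) /= big1 ?mul1r => [|i /setIP[_ ->]//].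
    by congr (_ * _); apply: eq_bigr => i /setDP[_ /negPf->].
  have := uT i iT; rewrite /represents; case: ifP => // iB [fix_i _].
  by rewrite mul1r; apply: subprod_fixS fix_i; apply: upto_sub.
have sub : B \subset ~: (T :\: B).
  by rewrite subsetC; apply/subsetP=> i; rewrite !inE => /andP[].
rewrite [RHS](subprodS (subsetT (T :\: B))) setTD (subprodS sub).
by rewrite mulrA TB.
Qed.

End Sequence.

Theorem corollary3p2 (R : finComPzRingType) :
  (davenport_ring R <= davenport_units R + n2 R)%N.
Proof.
apply: davenport_le => [|A].
  by rewrite addn_gt0; have [-> _] := davenportP (@unitsM R).
have [T [T0 eqT]] := dropped_subproduct (tnth A) (leqnn _).
apply/existsP; exists (~: T); rewrite properT -setC0 (inj_eq (@setC_inj _)) T0.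
apply/eqP; transitivity (subprod (tnth A) setT); first exact: eqT.
by apply: eq_bigl => i; rewrite inE.
Qed.
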